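(* Let $m$ be a positive integer and let $\Gamma=\mathrm{Cay}(\mathbb{Z}_{2m},S)$ be a circulant graph. If the Cayley graph $\mathrm{Cay}\big(\mathbb{Z}_{2m},(S\setminus\{m\})+m\big)$ has an automorphism fixing $0$ but moving $m$, then $\Gamma$ is unstable.
   Context: For an additive group $G$ and an inverse-closed subset $S\subseteq G\setminus\{0\}$, the Cayley graph $\mathrm{Cay}(G,S)$ has vertex set $G$, with $x\sim y$ iff $y-x\in S$; it is a circulant graph when $G$ is cyclic. For $A\subseteq G$ and $g\in G$, $A+g=\{a+g: a\in A\}$. A graph $\Lambda$ is stable if $\mathrm{Aut}(\Lambda\times K_2)=\mathrm{Aut}(\Lambda)\times\mathrm{Aut}(K_2)$, where $\Lambda\times K_2$ is the direct product (vertex set $V(\Lambda)\times V(K_2)$, $(a,x)\sim(b,y)$ iff $a\sim b$ and $x\sim y$) on which $\mathrm{Aut}(\Lambda)\times\mathrm{Aut}(K_2)$ acts coordinatewise; otherwise $\Lambda$ is unstable. *)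

(* Defs.v *)
From mathcomp Require Import all_boot all_order all_fingroup all_algebra.

Set Implicit Arguments.
Unset Strict Implicit.
Unset Printing Implicit Defensive.

Import GRing.Theory.
Local Open Scope ring_scope.

(* A graph on a finite type is given by its adjacency relation. *)

Definition graph_aut (T : finType) (e : rel T) : {set {perm T}} :=
  [set s : {perm T} | [forall x, forall y, e (s x) (s y) == e x y]].

Lemma graph_aut_group_set (T : finType) (e : rel T) : group_set (graph_aut e).
Proof.
apply/group_setP; split=> [|s t].
  by rewrite inE; apply/forallP=> x; apply/forallP=> y; rewrite !perm1.
rewrite !inE => /forallP hs /forallP ht.
apply/forallP=> x; apply/forallP=> y; rewrite !permM.
by rewrite (eqP (forallP (ht _) _)) (forallP (hs x) y).
Qed.
Canonical graph_aut_group (T : finType) (e : rel T) : {group {perm T}} :=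
  Group (graph_aut_group_set e).

Definition direct_product (T U : finType) (e : rel T) (f : rel U) :
  rel (T * U) := [rel a b | e a.1 b.1 && f a.2 b.2].

Definition K2 : rel 'I_2 := [rel x y | x != y].

Lemma perm_pair_inj (T U : finType) (s : {perm T}) (t : {perm U}) :
  injective (fun a : T * U => (s a.1, t a.2)).
Proof. by move=> [x u] [y v] [/perm_inj -> /perm_inj ->]. Qed.

Definition perm_pair (T U : finType) (s : {perm T}) (t : {perm U}) :
  {perm T * U} := perm (@perm_pair_inj T U s t).

(* Aut(e) x Aut(K2) is regarded as a set of permutations of V(e) x V(K2)
   through its coordinatewise action, which is faithful (as soon as V(e) is
   nonempty) and by automorphisms. *)
Definition stable (T : finType) (e : rel T) : Prop :=
  graph_aut (direct_product e K2) =
  [set perm_pair s t | s in graph_aut e, t in graph_aut K2].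

Definition unstable (T : finType) (e : rel T) : Prop := ~ stable e.

Definition connection_set (G : finZmodType) (S : {set G}) : Prop :=
  0 \notin S /\ {in S, forall x, - x \in S}.

Definition Cay (G : finZmodType) (S : {set G}) : rel G :=
  [rel x y | y - x \in S].

Lemma Cay_irr (G : finZmodType) (S : {set G}) :
  connection_set S -> irreflexive (Cay S).
Proof. by case=> S0 _ x; rewrite /Cay /= subrr (negbTE S0). Qed.

Lemma Cay_sym (G : finZmodType) (S : {set G}) :
  connection_set S -> symmetric (Cay S).
Proof.
by case=> _ SN x y; rewrite /Cay /=; apply/idP/idP => /SN; rewrite opprB.
Qed.

Definition translate (G : finZmodType) (A : {set G}) (g : G) : {set G} :=
  [set a + g | a in A].

(* The hypothesis g + g = 0 holds for g = m in Z_(2m). *)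
Lemma connection_set_translate (G : finZmodType) (S : {set G}) (g : G) :
  g + g = 0 -> connection_set S -> connection_set (translate (S :\ g) g).
Proof.
move=> gg [S0 SN]; have gN : - g = g by apply/esym/eqP; rewrite -addr_eq0 gg.
split.
  apply/imsetP=> -[a]; rewrite !inE => /andP[ag _] /esym/eqP.
  by rewrite addr_eq0 gN (negbTE ag).
move=> _ /imsetP[a + ->]; rewrite !inE => /andP[ag aS].
apply/imsetP; exists (- a); last by rewrite opprD gN.
by rewrite !inE SN // andbT eqr_oppLR gN.
Qed.

(* Main.v *)
(* The shear (x, i) |-> (x + i m, i) of Z_2m x Z_2 is an involutive group
   automorphism, since 2m = 0.  It turns Cay(S) x K_2 into the Cayley graph
   whose edges join the two layers with differences in S', where
   S' = (S \ {m}) + m, together with 0 when m is in S.  An automorphism s of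
   Cay(S') therefore acts on it as s x id; conjugating back by the shear gives
   the automorphism (x, i) |-> (s(x + i m) + i m, i) of Cay(S) x K_2, which is
   coordinatewise only if s(m) + m = s(0). *)
Require Import Defs.
From mathcomp Require Import all_boot all_order all_fingroup all_algebra.

Import GRing.Theory.
Local Open Scope ring_scope.

(** Removing [g] costs the translate only [g + g = 0]; the second disjunct restores it. *)
Lemma mem_translate {G : finZmodType} (S : {set G}) (g x : G) :
  g + g = 0 ->
  (x \in S) = (x + g \in translate (S :\ g) g) || ((x + g == 0) && (g \in S)).
Proof.
move=> gg.
have gN : - g = g by apply/esym/eqP; rewrite -addr_eq0 gg.
rewrite /translate (mem_imset _ _ (addIr g)) !inE addr_eq0 gN.
by case: eqP => [->|_] //=; rewrite orbF.
Qed.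

Lemma shear_perm_inj {G : finZmodType} (g : G) (s : {perm G}) :
  injective (fun a : G * 'I_2 => (s (a.1 + g *+ a.2) + g *+ a.2, a.2)).
Proof. by move=> [x i] [y j] /= [+ ij]; rewrite ij => /addIr/perm_inj/addIr ->. Qed.

Definition shear_perm {G : finZmodType} (g : G) (s : {perm G}) :
  {perm G * 'I_2} := perm (shear_perm_inj g s).

(** Exactly one of [i] and [j] is 1, and [- g = g]. *)
Lemma shear_diff {G : finZmodType} (g x y : G) (i j : 'I_2) :
  g + g = 0 -> i != j ->
  (y + g *+ j) - (x + g *+ i) = y - x + g.
Proof.
move=> gg; have gN : - g = g by apply/esym/eqP; rewrite -addr_eq0 gg.
rewrite opprD addrACA => ij; congr (_ + _).
case: i j ij => [[|[|i]] //= hi] [[|[|j]] //= hj] _;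
by rewrite ?mulr0n ?mulr1n ?gN ?subr0 ?add0r.
Qed.

Lemma shear_perm_aut {G : finZmodType} (S : {set G}) (g : G) (s : {perm G}) :
  g + g = 0 -> s \in graph_aut (Cay (translate (S :\ g) g)) ->
  shear_perm g s \in graph_aut (Defs.direct_product (Cay S) K2).
Proof.
move=> gg; rewrite !inE => /forallP s_aut.
apply/forallP=> -[x i]; apply/forallP=> -[y j]; rewrite !permE /Defs.direct_product /K2 /Cay /=.
have [->|ij] := eqVneq i j; rewrite ?andbF // !andbT.
rewrite (mem_translate _ _ _ gg) [in X in _ == X](mem_translate _ _ _ gg).
rewrite -!(shear_diff _ _ _ i j gg ij).
have shearK z k : z + g *+ k + g *+ k = z.
  by rewrite -addrA -mulrnDl gg mul0rn addr0.
(* Difference 0 is preserved because [s] is injective. *)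
rewrite !shearK !subr_eq0 (inj_eq perm_inj).
by have /eqP := forallP (s_aut (x + g *+ i)) (y + g *+ j); rewrite /Cay /= => ->.
Qed.

Lemma Cay_unstable {G : finZmodType} (S : {set G}) (g : G) (s : {perm G}) :
  g + g = 0 -> s \in graph_aut (Cay (translate (S :\ g) g)) ->
  s 0 = 0 -> s g <> g -> unstable (Cay S).
Proof.
move=> gg s_aut s0 sg st; apply: sg.
have := shear_perm_aut _ _ _ gg s_aut; rewrite st => /imset2P[u t _ _ E].
(* The first coordinate of [perm_pair u t] ignores the layer, so both points over 0 yield [u 0]. *)
have := congr1 (fun p : {perm G * 'I_2} => (p (0, ord0)).1) E.
have := congr1 (fun p : {perm G * 'I_2} => (p (0, ord_max)).1) E.
rewrite !permE /= !mulr0n !mulr1n !addr0 add0r s0 => <- /esym/eqP.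
by rewrite addr_eq0 => /eqP ->; apply/esym/eqP; rewrite -addr_eq0 gg.
Qed.

Theorem theorem1p4 (m : nat) (m_gt0 : (0 < m)%N)
  (S : {set 'Z_(2 * m)}) (S_conn : connection_set S)
  (h : exists2 s : {perm 'Z_(2 * m)},
         s \in graph_aut (Cay (translate (S :\ m%:R) m%:R))
         & s 0 = 0 /\ s m%:R <> m%:R) :
  unstable (Cay S).
Proof.
case: h => s s_aut [s0 sm]; apply: Cay_unstable s_aut s0 sm.
(* [0 < m] gives [1 < 2 * m], so ['Z_(2 * m)] has modulus [2 * m]. *)
by rewrite -natrD addnn -mul2n pchar_Zp // leq_pmulr.
Qed.
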